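(* Let $q$ be not a root of unity. The representations $R_l^{(1)}$, $l=0,\frac12,1,\frac32,\dots$, of $U_q(\mathrm{so}_3)$ are irreducible. The representations $R_l^{(\mathrm i)}$ and $R_l^{(-\mathrm i)}$, $l=\frac12,\frac32,\frac52,\dots$, of $U_q(\mathrm{so}_3)$ are reducible.
   Context: $q\in\mathbf C$, $q\ne0$, with a fixed square root $q^{1/2}$; $\mathrm i=\sqrt{-1}$; $[a]=\frac{q^a-q^{-a}}{q-q^{-1}}$. $U_q(\mathrm{so}_3)$ is the unital associative complex algebra generated by $I_1,I_2,I_3$ with defining relations $q^{1/2}I_1I_2-q^{-1/2}I_2I_1=I_3$, $q^{1/2}I_2I_3-q^{-1/2}I_3I_2=I_1$, $q^{1/2}I_3I_1-q^{-1/2}I_1I_3=I_2$. Let $\mathcal H_l$ have basis $|m\rangle$, $m=-l,-l+1,\dots,l$. Define operators on $\mathcal H_l$ by $T_l^{(1)}(q^H)|m\rangle=q^m|m\rangle$, $T_l^{(1)}(E)|m\rangle=[l-m]\,|m+1\rangle$, $T_l^{(1)}(F)|m\rangle=[l+m]\,|m-1\rangle$, and $T_l^{(\pm\mathrm i)}(q^H)|m\rangle=\pm\mathrm i q^m|m\rangle$, $T_l^{(\pm\mathrm i)}(E)=T_l^{(1)}(E)$, $T_l^{(\pm\mathrm i)}(F)=-T_l^{(1)}(F)$, with $T(q^{-H})=T(q^H)^{-1}$ (these are representations of the quantum algebra $U_q(\mathrm{sl}_2)$). For $\omega\in\{1,\mathrm i,-\mathrm i\}$ (with $l\in\{\frac12,\frac32,\dots\}$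 when $\omega=\pm\mathrm i$), writing $T=T_l^{(\omega)}$, the representation $R=R_l^{(\omega)}$ of $U_q(\mathrm{so}_3)$ on $\mathcal H_l$ is defined by $R(I_1)=\frac{\mathrm i}{q-q^{-1}}(T(q^H)-T(q^{-H}))$, $R(I_2)=(T(E)-T(F))(T(q^H)+T(q^{-H}))^{-1}$, $R(I_3)=(\mathrm i q^{-1/2}T(q^H)T(E)+\mathrm i q^{-1/2}T(q^{-H})T(F))(T(q^H)+T(q^{-H}))^{-1}$. *)

(* Defs.v *)
From HB Require Import structures.
From mathcomp Require Import all_boot all_order all_algebra.
From mathcomp Require Import finmap boolp monalg.

Set Implicit Arguments.
Unset Strict Implicit.
Unset Printing Implicit Defensive.

Import GRing.Theory.
Local Open Scope ring_scope.
Local Open Scope quotient_scope.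

(* Quotient of an algebra by the two-sided ideal generated by a set [rel]. *)
Section AlgebraQuotient.
Variables (F : fieldType) (A : algType F) (rel : A -> Prop).

Definition two_sided_ideal (J : A -> Prop) : Prop :=
  [/\ J 0, forall x y, J x -> J y -> J (x - y)
    & forall a b x, J x -> J (a * x * b)].

Definition gen_ideal : A -> bool := fun x =>
  `[< forall J, two_sided_ideal J -> (forall r, rel r -> J r) -> J x >].

Lemma gen_idealP x : reflect
  (forall J, two_sided_ideal J -> (forall r, rel r -> J r) -> J x)
  (x \in gen_ideal).
Proof. exact: asboolP. Qed.

Lemma gen_ideal_zmod_closed : zmod_closed gen_ideal.
Proof.
split=> [|x y /gen_idealP xI /gen_idealP yI]; apply/gen_idealP => J JI Jr.
  by case: JI.
by case: (JI) => _ JB _; apply: JB; [apply: xI | apply: yI].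
Qed.

HB.instance Definition _ :=
  GRing.isZmodClosed.Build A gen_ideal gen_ideal_zmod_closed.

Lemma gen_idealM a b x : x \in gen_ideal -> a * x * b \in gen_ideal.
Proof.
move=> /gen_idealP xI; apply/gen_idealP => J JI Jr.
by case: (JI) => _ _; apply; apply: xI.
Qed.

Lemma gen_ideal_rel r : rel r -> r \in gen_ideal.
Proof. by move=> rr; apply/gen_idealP => J _; apply. Qed.

Lemma gen_ideal_ker (S : nzRingType) (e : {rmorphism A -> S}) :
  (forall r, rel r -> e r = 0) -> forall x, x \in gen_ideal -> e x = 0.
Proof.
move=> er x /gen_idealP /(_ (fun x => e x = 0)); apply=> //.
split=> [|y z ey ez|a b y ey]; first exact: rmorph0.
  by rewrite rmorphB ey ez subr0.
by rewrite !rmorphM ey mulr0 mul0r.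
Qed.

Definition alg_quot : Type :=
  Quotient.quot (GRing.ZmodClosed.clone A gen_ideal _).
HB.instance Definition _ := GRing.Zmodule.on alg_quot.

Definition alg_pi (x : A) : alg_quot :=
  \pi_(Quotient.quot (GRing.ZmodClosed.clone A gen_ideal _)) x.

Lemma alg_piP x y : reflect (alg_pi x = alg_pi y) (x - y \in gen_ideal).
Proof. by rewrite Quotient.idealrBE; apply: eqP. Qed.

Lemma alg_piK (u : alg_quot) : alg_pi (repr u) = u.
Proof. exact: reprK. Qed.

Lemma alg_pi_repr x : x - repr (alg_pi x) \in gen_ideal.
Proof. by apply/alg_piP; rewrite alg_piK. Qed.

Lemma alg_piD x y : alg_pi (x + y) = alg_pi x + alg_pi y.
Proof. exact: Quotient.pi_add. Qed.

Definition alg_quot_one : alg_quot := alg_pi 1.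
Definition alg_quot_mul (u v : alg_quot) : alg_quot :=
  alg_pi (repr u * repr v).
Definition alg_quot_scale (c : F) (u : alg_quot) : alg_quot :=
  alg_pi (c *: repr u).

Lemma alg_pi_mul x y : alg_pi (x * y) = alg_quot_mul (alg_pi x) (alg_pi y).
Proof.
apply/alg_piP; rewrite -[x * y](addrNK (x * repr (alg_pi y))) -mulrBr.
rewrite -addrA -mulrBl; apply: ((@rpredD _ (GRing.ZmodClosed.clone A gen_ideal _))).
  by rewrite -[_ * _]mulr1; apply/gen_idealM/alg_pi_repr.
by rewrite -[X in X * _]mul1r; apply/gen_idealM/alg_pi_repr.
Qed.

Lemma alg_pi_scale c x : alg_pi (c *: x) = alg_quot_scale c (alg_pi x).
Proof.
apply/alg_piP; rewrite -scalerBr -[_ - _]mul1r scalerAl -[_ * _]mulr1.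
by apply/gen_idealM/alg_pi_repr.
Qed.

Lemma alg_quot_mulA : associative alg_quot_mul.
Proof.
move=> u v w; rewrite -[u]alg_piK -[v]alg_piK -[w]alg_piK.
by rewrite -!alg_pi_mul mulrA.
Qed.

Lemma alg_quot_mul1r : left_id alg_quot_one alg_quot_mul.
Proof. by move=> u; rewrite -[u]alg_piK -alg_pi_mul mul1r. Qed.

Lemma alg_quot_mulr1 : right_id alg_quot_one alg_quot_mul.
Proof. by move=> u; rewrite -[u]alg_piK -alg_pi_mul mulr1. Qed.

Lemma alg_quot_mulDl : left_distributive alg_quot_mul +%R.
Proof.
move=> u v w; rewrite -[u]alg_piK -[v]alg_piK -[w]alg_piK.
by rewrite -alg_piD -!alg_pi_mul mulrDl alg_piD.
Qed.

Lemma alg_quot_mulDr : right_distributive alg_quot_mul +%R.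
Proof.
move=> u v w; rewrite -[u]alg_piK -[v]alg_piK -[w]alg_piK.
by rewrite -alg_piD -!alg_pi_mul mulrDr alg_piD.
Qed.

HB.instance Definition _ := GRing.Zmodule_isPzRing.Build alg_quot
  alg_quot_mulA alg_quot_mul1r alg_quot_mulr1 alg_quot_mulDl alg_quot_mulDr.

Lemma alg_quot_scalerA a b u :
  alg_quot_scale a (alg_quot_scale b u) = alg_quot_scale (a * b) u.
Proof. by rewrite -[u]alg_piK -!alg_pi_scale scalerA. Qed.

Lemma alg_quot_scale1r : left_id 1 alg_quot_scale.
Proof. by move=> u; rewrite -[u]alg_piK -alg_pi_scale scale1r. Qed.

Lemma alg_quot_scalerDr : right_distributive alg_quot_scale +%R.
Proof.
move=> c u v; rewrite -[u]alg_piK -[v]alg_piK.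
by rewrite -alg_piD -!alg_pi_scale scalerDr alg_piD.
Qed.

Lemma alg_quot_scalerDl u : {morph alg_quot_scale^~ u : a b / a + b}.
Proof.
by move=> a b; rewrite -[u]alg_piK -!alg_pi_scale scalerDl alg_piD.
Qed.

HB.instance Definition _ := GRing.Zmodule_isLmodule.Build F alg_quot
  alg_quot_scalerA alg_quot_scale1r alg_quot_scalerDr alg_quot_scalerDl.

Lemma alg_piM x y : alg_pi (x * y) = alg_pi x * alg_pi y.
Proof. exact: alg_pi_mul. Qed.

Lemma alg_piZ c x : alg_pi (c *: x) = c *: alg_pi x.
Proof. exact: alg_pi_scale. Qed.

Lemma alg_pi_is_zmod_morphism : zmod_morphism alg_pi.
Proof.
move=> x y; apply: (addIr (alg_pi y)).
by rewrite -alg_piD !addrNK.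
Qed.

HB.instance Definition _ :=
  GRing.isZmodMorphism.Build A alg_quot alg_pi alg_pi_is_zmod_morphism.

Lemma alg_pi_comb s t x y : alg_pi (s *: (x * y) - t *: (y * x))
  = s *: (alg_pi x * alg_pi y) - t *: (alg_pi y * alg_pi x).
Proof. by rewrite raddfB /= !(alg_piZ, alg_piM). Qed.

Lemma alg_quot_scalerAl (c : F) (u v : alg_quot) :
  c *: (u * v) = (c *: u) * v.
Proof.
by rewrite -[u]alg_piK -[v]alg_piK -alg_piM -!alg_piZ -alg_piM scalerAl.
Qed.

Lemma alg_quot_scalerAr (c : F) (u v : alg_quot) :
  c *: (u * v) = u * (c *: v).
Proof.
by rewrite -[u]alg_piK -[v]alg_piK -alg_piM -!alg_piZ -alg_piM scalerAr.
Qed.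

Lemma alg_quot_neq0 (S : nzRingType) (e : {rmorphism A -> S}) :
  (forall r, rel r -> e r = 0) -> (1 : alg_quot) != 0.
Proof.
move=> er; rewrite -(raddf0 alg_pi); apply/eqP => /alg_piP.
rewrite subr0 => /(gen_ideal_ker er).
by move/eqP; rewrite rmorph1 oner_eq0.
Qed.

End AlgebraQuotient.

Section MonoidAlgebra.
Variables (F : fieldType) (M : monomType).

Lemma malg_scalerAr (c : F) (x y : {malg F[M]}) : c *: (x * y) = x * (c *: y).
Proof.
apply/malgP => k; rewrite mcoeffZ mcoeffMl.
rewrite (mcoeffMlw k (fsubset_refl (msupp x)) (@msuppZ_le _ _ c y)).
rewrite big_distrr /=; apply: eq_bigr => k1 _.
rewrite big_distrr /=; apply: eq_bigr => k2 _.
by rewrite mcoeffZ mulrnAr mulrCA.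
Qed.

End MonoidAlgebra.

Section Uq.
Variable F : fieldType.

(* The free algebra on three letters, as the algebra of the free monoid.  It is
   an alias because the algType structure on {malg _[_]} is already keyed to
   commutative monoids. *)
Definition free3 : Type := {malg F[{fmonom 'I_3}]}.
HB.instance Definition _ := GRing.Lalgebra.on free3.
HB.instance Definition _ :=
  GRing.Lalgebra_isAlgebra.Build F free3 (@malg_scalerAr F {fmonom 'I_3}).

Definition letter (j : 'I_3) : free3 := << fmu j >>.

(* [sq] stands for the chosen square root of [q]. *)
Variable sq : F.

Definition qcomm (A : lalgType F) (x y : A) : A :=
  sq *: (x * y) - sq^-1 *: (y * x).

Definition so3_relator (x : free3) : Prop :=
  let x1 := letter 0 in let x2 := letter 1 in let x3 := letter 2 in
  [\/ x = qcomm x1 x2 - x3, x = qcomm x2 x3 - x1 | x = qcomm x3 x1 - x2].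

Definition Uq_so3 : Type := alg_quot so3_relator.
HB.instance Definition _ := GRing.PzRing.on Uq_so3.
HB.instance Definition _ := GRing.Lmodule.on Uq_so3.

Lemma qcomm_ker (A : lalgType F) (S : nzRingType) (e : {rmorphism A -> S})
    (x y z : A) : e x = 0 -> e y = 0 -> e z = 0 -> e (qcomm x y - z) = 0.
Proof.
move=> ex ey ez; rewrite /qcomm -[sq *: _]mulr_algl -[_^-1 *: _]mulr_algl.
by rewrite !(rmorphB, rmorphM) ex ey ez !(mulr0, subr0).
Qed.

Definition const_coef : free3 -> F := mcoeff (mone : {fmonom 'I_3}).
HB.instance Definition _ := GRing.RMorphism.on const_coef.

Lemma const_coef_letter j : const_coef (letter j) = 0.
Proof.
rewrite /const_coef /letter mcoeffU; case: eqP => // /(congr1 (@fmonom_val _)).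
by rewrite fm1 fmU.
Qed.

Lemma Uq_one_neq0 : (1 : Uq_so3) != 0.
Proof.
apply: (@alg_quot_neq0 _ _ _ _ const_coef).
by move=> r [] ->; apply: qcomm_ker; apply: const_coef_letter.
Qed.

HB.instance Definition _ :=
  GRing.PzSemiRing_isNonZero.Build Uq_so3 Uq_one_neq0.
HB.instance Definition _ :=
  GRing.Lmodule_isLalgebra.Build F Uq_so3 (@alg_quot_scalerAl _ _ so3_relator).
HB.instance Definition _ :=
  GRing.Lalgebra_isAlgebra.Build F Uq_so3 (@alg_quot_scalerAr _ _ so3_relator).

Definition I1 : Uq_so3 := alg_pi so3_relator (letter 0).
Definition I2 : Uq_so3 := alg_pi so3_relator (letter 1).
Definition I3 : Uq_so3 := alg_pi so3_relator (letter 2).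

Lemma Uq_qcomm x y z : so3_relator (qcomm x y - z) ->
  qcomm (alg_pi so3_relator x : Uq_so3) (alg_pi so3_relator y)
  = alg_pi so3_relator z.
Proof.
move=> /gen_ideal_rel /alg_piP <-.
exact/esym/alg_pi_comb.
Qed.

Lemma Uq_rel12 : qcomm I1 I2 = I3.
Proof. by apply: Uq_qcomm; constructor 1. Qed.

Lemma Uq_rel23 : qcomm I2 I3 = I1.
Proof. by apply: Uq_qcomm; constructor 2. Qed.

Lemma Uq_rel31 : qcomm I3 I1 = I2.
Proof. by apply: Uq_qcomm; constructor 3. Qed.

End Uq.

Arguments I1 {F} sq.
Arguments I2 {F} sq.
Arguments I3 {F} sq.

Section Representations.
Variable F : fieldType.

(* A representation of an algebra on F^(n+1) is an algebra morphism into
   'M_(n.+1), the matrices acting on column vectors from the left. *)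
Section Reducibility.
Variables (A : algType F) (n : nat).
Variable rho : {lrmorphism A -> 'M[F]_n.+1}.

Definition invariant_subspace (W : {vspace 'cV[F]_n.+1}) : Prop :=
  forall (a : A) (v : 'cV[F]_n.+1), v \in W -> rho a *m v \in W.

Definition irreducible_rep : Prop :=
  forall W, invariant_subspace W -> W = 0%VS \/ W = fullv.

Definition reducible_rep : Prop :=
  exists W, [/\ invariant_subspace W, W <> 0%VS & W <> fullv].

End Reducibility.

(* q-number [a]; only integer values of [a] occur below. *)
Definition qnum (q : F) (a : int) : F :=
  (q ^ a - q ^ (- a)) / (q - q^-1).

Record sl2_ops (n : nat) := Sl2Ops {
  op_qH : 'M[F]_n;
  op_E : 'M[F]_n;
  op_F : 'M[F]_n
}.

(* The half-integer l is encoded by d = 2l, and the basis vector |m> of H_l by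
   the k-th unit column vector of F^(d+1) with k = l + m; so q^m is
   sq^(2k - d), l - m = d - k and l + m = k.  The column k of a matrix is the
   image of |m>. *)
Section Ops.
Variables (q sq : F) (d : nat).

Definition T_one : sl2_ops d.+1 := Sl2Ops
  (\matrix_(j, k) if j == k then sq ^ ((2 * k)%N%:Z - d%:Z) else 0)
  (\matrix_(j, k) if j == k.+1 :> nat then qnum q (d%:Z - k%:Z) else 0)
  (\matrix_(j, k) if j.+1 == k :> nat then qnum q k%:Z else 0).

(* T^(i) and T^(-i) are obtained for [eps] = i and [eps] = - i. *)
Definition T_im (eps : F) : sl2_ops d.+1 := Sl2Ops
  (eps *: op_qH T_one) (op_E T_one) (- op_F T_one).

End Ops.
End Representations.

Definition so3_rep_of (C : numClosedFieldType) (q sq : C) (d : nat)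
    (T : sl2_ops C d.+1)
    (R : {lrmorphism Uq_so3 sq -> 'M[C]_d.+1}) : Prop :=
  let qH := op_qH T in
  let qHV := invmx qH in
  let D := invmx (qH + qHV) in
  [/\ R (I1 sq) = ('i / (q - q^-1)) *: (qH - qHV),
      R (I2 sq) = (op_E T - op_F T) *m D
    & R (I3 sq) = (('i * sq^-1) *: (qH *m op_E T)
                   + ('i * sq^-1) *: (qHV *m op_F T)) *m D].

(* Main.v *)
Require Import Defs.
From HB Require Import structures.
From mathcomp Require Import all_boot all_order all_algebra.
From mathcomp Require Import monalg ring zify.
From mathcomp Require Import reals complex.

(** Write H, E, F for the images of q^H, E, F and V for the inverse of H.

    _Existence._ The formulas for R(I_1), R(I_2), R(I_3) satisfy the three
    defining relations of U_q(so_3) whenever H, E, F satisfy those of U_q(sl_2)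
    and H + V is invertible ([so3_relation12], [so3_relation23],
    [so3_relation31]): once (H + V)^-1, which commutes with H, is moved to the
    right, the first and third relations only use the q-commutation of H with E
    and F, while in the second one all terms cancel but [E, F] (H + V)^-1.  The
    presentation of U_q(so_3) then provides the morphism ([Uq_so3_universal],
    [so3_rep_exists]).  As q is not a root of unity, q^m + q^-m never vanishes,
    and q^m - q^-m does not vanish for half-integral m: H + V is invertible
    both for T^(1) and for T^(i), T^(-i).

    _Irreducibility of R^(1)._ R(I_1) is diagonal with entries proportional to
    q^m - q^-m, which are pairwise distinct because q^n is never -1 and is 1
    only for n = 0 ([weightBV_inj]).  Hence an invariant subspace contains
    every basis vector on which one of its elements has a nonzero coordinate.
    R(I_2) moves |m> to |m + 1> and |m - 1> with nonzero coefficients, so a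
    nonzero invariant subspace contains the whole basis
    ([tridiag_stable_trivial], [T_one_irreducible]).

    _Reducibility of R^(i) and R^(-i)._ Here the eigenvalues of R(I_1) are
    proportional to q^m + q^-m and do not separate m from -m.  The operator
    [flip], sending |m> to (-1)^(l+m) |-m>, commutes with R(I_1) and R(I_2),
    hence with the whole algebra.  For half-integral l its square is -1 and it
    is not a scalar, so one of its eigenspaces is a proper nonzero invariant
    subspace ([reducible_of_commutant], [T_im_reducible]). *)

Set Implicit Arguments.
Unset Strict Implicit.
Unset Printing Implicit Defensive.

Import GRing.Theory Num.Theory.
Local Open Scope ring_scope.

(** * Morphisms out of U_q(so_3) and induction on its elements *)

Lemma rmorph_qcomm (F : fieldType) (sq : F) (A B : lalgType F)
    (e : {lrmorphism A -> B}) x y z :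
  e (qcomm sq x y - z) = qcomm sq (e x) (e y) - e z.
Proof. by rewrite /qcomm !linearB !linearZ /= !rmorphM. Qed.

Section UniversalProperty.
Variables (F : fieldType) (sq : F) (A : algType F) (x : 'I_3 -> A).

Definition word_eval (m : {fmonom 'I_3}) : A := \prod_(i <- fmonom_val m) x i.

Lemma word_eval_mmorphism : mmorphism word_eval.
Proof.
by split=> [m1 m2|]; rewrite /word_eval ?fm1 ?big_nil // fmM big_cat.
Qed.

HB.instance Definition _ :=
  isMultiplicative.Build {fmonom 'I_3} A word_eval word_eval_mmorphism.

Definition free3_eval : free3 F -> A := mmap (in_alg A) word_eval.

Lemma free3_eval_zmod_morphism : zmod_morphism free3_eval.
Proof. exact: mmapB. Qed.

Lemma free3_eval_monoid_morphism : monoid_morphism free3_eval.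
Proof.
have comm (g : {malg F[{fmonom 'I_3}]}) m m' :
    GRing.comm (in_alg A g@_m) (word_eval m').
  by rewrite /GRing.comm /= mulr_algl mulr_algr.
have [evalM eval1] := commr_mmap_is_multiplicative comm.
by split; [exact: eval1 | exact: evalM].
Qed.

Lemma free3_eval_scalable : scalable free3_eval.
Proof. by move=> c g; rewrite /free3_eval mmapZ /= mulr_algl. Qed.

HB.instance Definition _ :=
  GRing.isZmodMorphism.Build (free3 F) A free3_eval free3_eval_zmod_morphism.
HB.instance Definition _ :=
  GRing.isMonoidMorphism.Build (free3 F) A free3_eval
    free3_eval_monoid_morphism.
HB.instance Definition _ :=
  GRing.isScalable.Build F (free3 F) A *:%R free3_eval free3_eval_scalable.

Lemma free3_eval_letter j : free3_eval (letter F j) = x j.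
Proof.
by rewrite /free3_eval /letter mmapU /= scale1r mul1r /word_eval fmU big_seq1.
Qed.

Definition so3_triple :=
  [/\ qcomm sq (x 0) (x 1) = x 2, qcomm sq (x 1) (x 2) = x 0
    & qcomm sq (x 2) (x 0) = x 1].

Hypothesis x_rel : so3_triple.

Lemma free3_eval_relator r : so3_relator sq r -> free3_eval r = 0.
Proof.
case: x_rel => x12 x23 x31.
have evB j k m : free3_eval (qcomm sq (letter F j) (letter F k) - letter F m)
    = qcomm sq (x j) (x k) - x m.
  by rewrite -!free3_eval_letter; apply: (rmorph_qcomm sq free3_eval).
by case=> ->; rewrite evB ?x12 ?x23 ?x31 subrr.
Qed.

(** Carrying the relations as an argument lets the morphism structures below be
    attached to the function itself. *)
Definition Uq_eval of so3_triple : Uq_so3 sq -> A :=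
  fun u => free3_eval (repr u).

Local Notation ev := (Uq_eval x_rel).

Lemma Uq_eval_pi u : ev (alg_pi (so3_relator sq) u) = free3_eval u.
Proof.
apply/esym/eqP; rewrite -subr_eq0 -rmorphB /=.
exact/eqP/(gen_ideal_ker free3_eval_relator)/alg_pi_repr.
Qed.

Lemma Uq_eval_zmod_morphism : zmod_morphism ev.
Proof.
move=> u v; rewrite -[u]alg_piK -[v]alg_piK -[in LHS](raddfB (alg_pi _)).
by rewrite !Uq_eval_pi rmorphB.
Qed.

Lemma Uq_eval_monoid_morphism : monoid_morphism ev.
Proof.
split; first exact: etrans (Uq_eval_pi 1) (rmorph1 free3_eval).
move=> u v.
transitivity (ev (alg_pi (so3_relator sq) (repr u * repr v))).
  by rewrite alg_piM !alg_piK.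
rewrite Uq_eval_pi; exact: (rmorphM free3_eval).
Qed.

Lemma Uq_eval_scalable : scalable ev.
Proof.
move=> c u; transitivity (ev (alg_pi (so3_relator sq) (c *: repr u))).
  by rewrite alg_piZ alg_piK.
rewrite Uq_eval_pi; exact: free3_eval_scalable.
Qed.

HB.instance Definition _ :=
  GRing.isZmodMorphism.Build (Uq_so3 sq) A ev Uq_eval_zmod_morphism.
HB.instance Definition _ :=
  GRing.isMonoidMorphism.Build (Uq_so3 sq) A ev Uq_eval_monoid_morphism.
HB.instance Definition _ :=
  GRing.isScalable.Build F (Uq_so3 sq) A *:%R ev Uq_eval_scalable.

Lemma Uq_so3_universal : exists R : {lrmorphism Uq_so3 sq -> A},
  [/\ R (I1 sq) = x 0, R (I2 sq) = x 1 & R (I3 sq) = x 2].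
Proof.
by exists ev; split; rewrite [LHS]Uq_eval_pi free3_eval_letter.
Qed.

End UniversalProperty.

Section Induction.
Variables (F : fieldType) (sq : F).

(** I_3 needs no case: it is the q-commutator of I_1 and I_2. *)
Lemma Uq_so3_ind (P : Uq_so3 sq -> Prop) :
    P 1 -> P (I1 sq) -> P (I2 sq) ->
    (forall c u v, P u -> P v -> P (c *: u + v)) ->
    (forall u v, P u -> P v -> P (u * v)) ->
  forall u, P u.
Proof.
move=> P1 PI1 PI2 Plin PM.
have P0 : P 0.
  by have := Plin (-1) _ _ P1 P1; rewrite scaleN1r addNr.
have PZ c u : P u -> P (c *: u) by move=> /(Plin c) /(_ P0); rewrite addr0.
have PI3 : P (I3 sq).
  rewrite -(Uq_rel12 sq) /qcomm -scaleNr.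
  by apply: (Plin); [apply: PM | apply/PZ/PM].
have PD u v : P u -> P v -> P (u + v).
  by move=> Pu Pv; rewrite -[u]scale1r; apply: Plin.
have PI j : P (alg_pi (so3_relator sq) (letter F j)).
  case: j => [[|[|[|//]]] lt_j3].
  - by rewrite (_ : Ordinal _ = 0) //; apply/val_inj.
  - by rewrite (_ : Ordinal _ = 1) //; apply/val_inj.
  - by rewrite (_ : Ordinal _ = 2) //; apply/val_inj.
have Pw (m : {fmonom 'I_3}) : P (alg_pi (so3_relator sq) << m >>).
  case: m => s; elim: s => [|j s IHs]; first by rewrite -fmoneE; exact: P1.
  have -> : << FMonom (j :: s) >> = letter F j * << FMonom s >> :> free3 F.
    rewrite /letter; apply: etrans (esym (fgmulUU _ _ _ _)).
    by rewrite mulr1; congr (<< _ >>); apply/eqP; rewrite fmP fmM fmU.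
  by rewrite alg_piM; apply: PM.
move=> u; rewrite -[u]alg_piK (monalgE (repr u)).
apply: (big_ind (fun g => P (alg_pi (so3_relator sq) g))) => [|g h Pg Ph|m _].
- by rewrite raddf0.
- by rewrite alg_piD; apply: PD.
have -> : << (repr u)@_m *g m >> = (repr u)@_m *: << m >> :> free3 F.
  by apply/malgP=> k; rewrite mcoeffZ !mcoeffU mulrnAr mulr1.
by rewrite alg_piZ; apply: PZ.
Qed.

End Induction.

(** * The relations of U_q(so_3) from those of U_q(sl_2) *)

(** [E, F] = [2H], with (q - q^-1) [2H] = (q^H)^2 - (q^-H)^2. *)
Definition sl2_relations (F : fieldType) (q : F) (n : nat) (T : sl2_ops F n) :=
  [/\ op_qH T \in unitmx,
      op_qH T *m op_E T = q *: (op_E T *m op_qH T),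
      op_qH T *m op_F T = q^-1 *: (op_F T *m op_qH T)
    & op_E T *m op_F T - op_F T *m op_E T
      = (q - q^-1)^-1
        *: (op_qH T *m op_qH T - invmx (op_qH T) *m invmx (op_qH T))].

Section QuantumRelations.
Variables (F : fieldType) (q sq w : F) (n : nat).
Hypotheses (q_neq0 : q != 0) (sqE : sq ^+ 2 = q) (qq_neq0 : q - q^-1 != 0).
Hypothesis (wE : w ^+ 2 = -1).
Variables (H V E G D : 'M[F]_n.+1).
Hypotheses (HV : H *m V = 1%:M) (VH : V *m H = 1%:M).
Hypotheses (SD : (H + V) *m D = 1%:M) (DS : D *m (H + V) = 1%:M).
Hypotheses (HE : H *m E = q *: (E *m H)) (HG : H *m G = q^-1 *: (G *m H)).
Hypothesis EG : E *m G - G *m E = (q - q^-1)^-1 *: (H *m H - V *m V).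

Let X1 : 'M[F]_n.+1 := (w / (q - q^-1)) *: (H - V).
Let X2 : 'M[F]_n.+1 := (E - G) *m D.
Let X3 : 'M[F]_n.+1 := ((w * sq^-1) *: (H *m E) + (w * sq^-1) *: (V *m G)) *m D.

Let sq_neq0 : sq != 0.
Proof. by apply: contra_neq q_neq0 => s0; rewrite -sqE s0 expr0n. Qed.

Let sqVE : sq^-1 * sq^-1 = q^-1.
Proof. by rewrite -invfM -expr2 sqE. Qed.

Let EH : E *m H = q^-1 *: (H *m E).
Proof. by rewrite HE scalerA mulVf // scale1r. Qed.
Let GH : G *m H = q *: (H *m G).
Proof. by rewrite HG scalerA mulfV // scale1r. Qed.

Let conjV (M : 'M[F]_n.+1) (c : F) :
  H *m M = c *: (M *m H) -> M *m V = c *: (V *m M).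
Proof.
move=> HM; rewrite -[LHS]mul1mx -VH -!mulmxA [H *m _]mulmxA HM.
by rewrite -scalemxAl -scalemxAr -!mulmxA HV mulmx1.
Qed.
Let EV : E *m V = q *: (V *m E). Proof. exact: conjV. Qed.
Let GV : G *m V = q^-1 *: (V *m G). Proof. exact: conjV. Qed.

Let comm_D (M : 'M[F]_n.+1) : M *m (H + V) = (H + V) *m M -> D *m M = M *m D.
Proof.
move=> MS; rewrite -[LHS]mulmx1 -SD mulmxA -[_ *m M *m _]mulmxA MS.
by rewrite mulmxA DS mul1mx.
Qed.
Let DH : D *m H = H *m D.
Proof. by apply: comm_D; rewrite mulmxDl mulmxDr HV VH. Qed.
Let DV : D *m V = V *m D.
Proof. by apply: comm_D; rewrite mulmxDl mulmxDr HV VH. Qed.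

Let DHV : D *m (H - V) = (H - V) *m D.
Proof. by rewrite mulmxBr mulmxBl DH DV. Qed.

Let sq2_neq0 : sq ^+ 2 * sq ^+ 2 - 1 != 0.
Proof.
apply: contra_neq qq_neq0 => q2; apply: (mulfI q_neq0).
by rewrite mulrBr mulfV // -sqE q2 mulr0.
Qed.

(** After D has been moved to the right and cancelled, the identity is linear in
    H E, V E, H G and V G, which are replaced by independent matrices. *)
Lemma so3_relation12 : qcomm sq X1 X2 = X3.
Proof.
rewrite /qcomm -!mulmxE.
have -> : X1 *m X2 = ((w / (q - q^-1)) *: ((H - V) *m (E - G))) *m D.
  by rewrite -!scalemxAl mulmxA.
have -> : X2 *m X1 = ((w / (q - q^-1)) *: ((E - G) *m (H - V))) *m D.
  by rewrite -scalemxAr -mulmxA DHV mulmxA scalemxAl.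
rewrite [sq *: _]scalemxAl [sq^-1 *: _]scalemxAl -mulmxBl; congr (_ *m D).
rewrite !(mulmxBl, mulmxBr) EH EV GH GV.
move: (H *m E) (V *m E) (H *m G) (V *m G) => M1 M2 M3 M4.
apply/matrixP=> i j; rewrite !mxE -sqE; field.
by rewrite sq_neq0 sq2_neq0.
Qed.

Lemma so3_relation31 : qcomm sq X3 X1 = X2.
Proof.
rewrite /qcomm -!mulmxE.
have -> : X3 *m X1
    = ((w * sq^-1 * (w / (q - q^-1))) *: ((H *m E + V *m G) *m (H - V))) *m D.
  rewrite /X1 /X3 -scalerDr -scalemxAr -[_ *m D *m _]mulmxA DHV mulmxA.
  by rewrite -!scalemxAl scalerA mulrC.
have -> : X1 *m X3
    = ((w * sq^-1 * (w / (q - q^-1))) *: ((H - V) *m (H *m E + V *m G))) *m D.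
  rewrite /X1 /X3 -scalerDr mulmxA -scalemxAr.
  by rewrite -!scalemxAl scalerA.
rewrite [sq *: _]scalemxAl [sq^-1 *: _]scalemxAl -mulmxBl; congr (_ *m D).
rewrite !(mulmxBr, mulmxBl, mulmxDl, mulmxDr) -!mulmxA EH EV GH GV -!scalemxAr.
rewrite (mulmxA H V) (mulmxA V H) (mulmxA H V) (mulmxA V H) HV VH !mul1mx.
move: (H *m (H *m E)) (V *m (V *m G)) => M1 M4.
apply/matrixP=> i j; rewrite !mxE.
have -> : w / sq * (w / (q - q^-1)) = - sq^-1 / (q - q^-1).
  by rewrite mulrACA -expr2 wE mulN1r mulNr.
rewrite -sqE; field.
by rewrite sq_neq0 sq2_neq0.
Qed.

(** As q^-1 H E = E H and q^-1 V G = G V, the q-commutator is w S D with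
    S = (E - G) D (H E + V G) - (E H + G V) D (E - G).  The terms of S with two
    E or two G cancel, which leaves E D (H + V) G - G D (H + V) E = E G - G E. *)
Lemma so3_relation23 : qcomm sq X2 X3 = X1.
Proof.
rewrite /qcomm -!mulmxE.
have -> : X1 = w *: ((E *m G - G *m E) *m D).
  rewrite EG /X1 -scalemxAl scalerA; congr (_ *: _).
  rewrite -[LHS]mulmx1 -SD mulmxA; congr (_ *m _).
  rewrite mulmxBl !mulmxDr HV VH.
  by apply/matrixP=> i j; rewrite !mxE; ring.
have -> : X2 *m X3 = (w / sq) *: (X2 *m (H *m E + V *m G) *m D).
  by rewrite /X3 -scalerDr -scalemxAl -scalemxAr mulmxA.
have -> : X3 *m X2 = (w / sq) *: ((H *m E + V *m G) *m D *m X2).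
  by rewrite /X3 -scalerDr -!scalemxAl.
rewrite !scalerA mulrA.
have -> : sq * w / sq = w by rewrite mulrAC mulfV // mul1r.
have -> : sq^-1 * (w / sq) = w * q^-1 by rewrite -sqVE; ring.
rewrite -scalerA -scalerBr; congr (_ *: _).
rewrite !mulmxA scalemxAl -mulmxBl; congr (_ *m D).
rewrite /X2 2!scalemxAl.
have -> : q^-1 *: (H *m E + V *m G) = E *m H + G *m V.
  by rewrite scalerDr EH GV.
have -> : (E *m H + G *m V) *m D = (E *m D) *m H + (G *m D) *m V.
  by rewrite mulmxDl -!mulmxA DH DV.
have DS' : D *m H + D *m V = 1%:M by rewrite -mulmxDr.
transitivity (E *m (D *m H + D *m V) *m G - G *m (D *m H + D *m V) *m E);
  last by rewrite DS' !mulmx1.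
rewrite !(mulmxBr, mulmxBl, mulmxDl, mulmxDr) !mulmxA.
by apply/matrixP=> i j; rewrite !mxE; ring.
Qed.

End QuantumRelations.

Lemma so3_rep_exists (C : numClosedFieldType) (q sq : C) (d : nat)
    (T : sl2_ops C d.+1) :
    q != 0 -> sq ^+ 2 = q -> q - q^-1 != 0 -> sl2_relations q T ->
    op_qH T + invmx (op_qH T) \in unitmx ->
  exists R : {lrmorphism Uq_so3 sq -> 'M[C]_d.+1}, so3_rep_of q T R.
Proof.
move=> q0 sqE qq0 [Hu HE HG EG] Su.
pose x (j : 'I_3) := nth 0 [::
  ('i / (q - q^-1)) *: (op_qH T - invmx (op_qH T));
  (op_E T - op_F T) *m invmx (op_qH T + invmx (op_qH T));
  (('i * sq^-1) *: (op_qH T *m op_E T)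
   + ('i * sq^-1) *: (invmx (op_qH T) *m op_F T))
  *m invmx (op_qH T + invmx (op_qH T))] j.
have [|R RE] := @Uq_so3_universal C sq 'M[C]_d.+1 x; last by exists R.
have [HV VH] := (mulmxV Hu, mulVmx Hu).
have [SD DS] := (mulmxV Su, mulVmx Su).
split.
- exact: (so3_relation12 'i q0 sqE qq0 HV VH SD DS HE HG).
- exact: (so3_relation23 'i q0 sqE HV VH SD DS HE HG EG).
- exact: (so3_relation31 q0 sqE qq0 (sqrCi _) HV VH SD DS HE HG).
Qed.

(** * Powers of a number that is not a root of unity *)

Section RootOfUnity.
Variables (F : numFieldType) (q : F).
Hypothesis q_neq0 : q != 0.
Hypothesis q_not_root : forall n : nat, (0 < n)%N -> ~~ n.-unity_root q.

Lemma expz_eq1 (n : int) : (q ^ n == 1) = (n == 0).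
Proof.
have pos k : (q ^+ k.+1 == 1) = false.
  by apply/negbTE; rewrite -unity_rootE q_not_root.
case: n => [[|n]|n]; first by rewrite expr0z !eqxx.
  exact: pos.
by rewrite NegzE -exprz_inv -exprnP exprVn invr_eq1 pos.
Qed.

Lemma expz_inj : injective (exprz q).
Proof.
move=> m n mn; apply/eqP; rewrite -subr_eq0 -expz_eq1 expfzDr //.
by rewrite mn -expfzDr // subrr.
Qed.

Lemma expz_neqN1 (n : int) : q ^ n != -1.
Proof.
apply/eqP=> qn; have : q ^ (n + n) == 1 by rewrite expfzDr // qn mulrNN mulr1.
rewrite expz_eq1 -mulr2n mulrn_eq0 => /eqP n0.
have /eqP : (2 : F) = 0 by rewrite -[2]/(1 + 1) -{1}[1](expr0z q) -n0 qn addNr.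
by rewrite pnatr_eq0.
Qed.

Lemma q_subV_neq0 : q - q^-1 != 0.
Proof.
rewrite subr_eq0 -[X in X == _]expr1z -exprN1.
by apply/eqP=> /expz_inj.
Qed.

Lemma qnum_eq0 (a : int) : (qnum q a == 0) = (a == 0).
Proof.
rewrite /qnum mulf_eq0 invr_eq0 (negbTE q_subV_neq0) orbF subr_eq0.
by rewrite (inj_eq expz_inj) -addr_eq0 -mulr2n mulrn_eq0.
Qed.

End RootOfUnity.

(** * The representation T^(1) of U_q(sl_2) in the weight basis *)

Lemma diag_mx_unitV (F : fieldType) (n : nat) (a : 'rV[F]_n) :
    (forall k, a 0 k != 0) ->
  diag_mx a \in unitmx /\ invmx (diag_mx a) = diag_mx (\row_k (a 0 k)^-1).
Proof.
move=> a_neq0.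
have aV : diag_mx a *m diag_mx (\row_k (a 0 k)^-1) = 1%:M.
  rewrite mulmx_diag -diag_const_mx; congr diag_mx.
  by apply/rowP=> k; rewrite !mxE mulfV.
have [au _] := mulmx1_unit aV.
by split=> //; rewrite -[LHS]mulmx1 -aV mulKmx.
Qed.

Section WeightBasis.
Variables (F : numFieldType) (q sq : F).
Hypotheses (q_neq0 : q != 0) (sqE : sq ^+ 2 = q).
Hypothesis q_not_root : forall n : nat, (0 < n)%N -> ~~ n.-unity_root q.
Variable d : nat.

Let T := T_one q sq d.

(** The eigenvalue q^m of q^H at |m>, m = k - d/2. *)
Definition weight (k : 'I_d.+1) : F := sq ^ ((2 * k)%N%:Z - d%:Z).

Let sq_neq0 : sq != 0.
Proof. by apply: contra_neq q_neq0 => s0; rewrite -sqE s0 expr0n. Qed.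

Lemma weight_neq0 k : weight k != 0.
Proof. exact: expfz_neq0. Qed.

Lemma weightM j k : weight j * weight k = q ^ ((j + k)%N%:Z - d%:Z).
Proof.
rewrite -sqE exprnP exprz_exp -expfzDr //; congr (_ ^ _).
by rewrite !PoszM !PoszD; lia.
Qed.

Lemma weightV j k : weight j / weight k = q ^ (j%:Z - k%:Z).
Proof.
rewrite -sqE exprnP exprz_exp invr_expz -expfzDr //; congr (_ ^ _).
by rewrite !PoszM; lia.
Qed.

Lemma T_one_qH : op_qH T = diag_mx (\row_k weight k).
Proof.
by apply/matrixP=> j k; rewrite !mxE; case: eqP => [->|].
Qed.

Lemma T_one_qH_unit : op_qH T \in unitmx.
Proof.
rewrite T_one_qH; apply: (diag_mx_unitV _).1 => k.
by rewrite mxE weight_neq0.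
Qed.

Lemma T_one_qHV : invmx (op_qH T) = diag_mx (\row_k (weight k)^-1).
Proof.
rewrite T_one_qH (diag_mx_unitV _).2 => [|k]; last by rewrite mxE weight_neq0.
by congr diag_mx; apply/rowP=> k; rewrite !mxE.
Qed.

(** The boundary cases come for free: E F kills the lowest vector and F E the
    highest one, in agreement with the factors [0]. *)
Lemma T_one_EF j k : (op_E T *m op_F T) j k
  = (j == k)%:R * (qnum q (d%:Z - k%:Z + 1) * qnum q k%:Z).
Proof.
rewrite mxE; case: k => [[|k] lt_k].
  rewrite big1 => [|i _]; last by rewrite !mxE mulr0.
  by rewrite {2}/qnum subrr mul0r !mulr0.
rewrite (bigD1 (Ordinal (ltnW lt_k))) //= big1 => [|i ne_ik].
  rewrite !mxE /= eqxx addr0 -val_eqE /=.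
  case: eqP => _; last by rewrite !mul0r.
  by rewrite mul1r; congr (qnum _ _ * _); lia.
by move: ne_ik; rewrite -val_eqE !mxE /= eqSS => /negbTE->; rewrite mulr0.
Qed.

Lemma T_one_FE j k : (op_F T *m op_E T) j k
  = (j == k)%:R * (qnum q (k%:Z + 1) * qnum q (d%:Z - k%:Z)).
Proof.
rewrite mxE; have [lt_kd|le_dk] := ltnP k d; last first.
  have kd : k = d :> nat by apply/eqP; rewrite eqn_leq le_dk -ltnS ltn_ord.
  rewrite big1 => [|i _]; last first.
    by rewrite !mxE kd (ltn_eqF (ltn_ord i)) mulr0.
  by rewrite kd subrr {2}/qnum oppr0 subrr mul0r !mulr0.
have lt_k1 : (k.+1 < d.+1)%N by [].
rewrite (bigD1 (Ordinal lt_k1)) //= big1 => [|i ne_ik].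
  rewrite !mxE /= eqxx addr0 eqSS -val_eqE /=.
  case: eqP => _; last by rewrite !mul0r.
  by rewrite mul1r; congr (qnum _ _ * _); lia.
by move: ne_ik; rewrite -val_eqE !mxE /= => /negbTE->; rewrite mulr0.
Qed.

Lemma T_one_sl2 : sl2_relations q T.
Proof.
have qq0 := q_subV_neq0 q_neq0 q_not_root.
have weight_next (i k : 'I_d.+1) : i = k.+1 :> nat -> weight i = q * weight k.
  move=> ik; rewrite -[LHS](divfK (weight_neq0 k)) weightV ik.
  by rewrite -addn1 PoszD addrAC subrr add0r expr1z.
split; first exact: T_one_qH_unit.
- rewrite T_one_qH mul_diag_mx mul_mx_diag; apply/matrixP=> j k; rewrite !mxE.
  case: eqP => [/weight_next->|_]; last by rewrite mul0r !mulr0.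
  by rewrite -mulrA [weight k * _]mulrC.
- rewrite T_one_qH mul_diag_mx mul_mx_diag; apply/matrixP=> j k; rewrite !mxE.
  case: eqP => [/esym/weight_next->|_]; last by rewrite mul0r !mulr0.
  by rewrite [RHS]mulrCA mulKf // mulrC.
apply/matrixP=> j k; rewrite T_one_qHV T_one_qH !mulmx_diag.
rewrite [LHS]mxE T_one_EF [X in _ + X]mxE T_one_FE !mxE.
case: eqP => [->|_]; last by rewrite !mulr0n !mul0r subr0 mulr0.
rewrite !mulr1n !mul1r -invfM weightM PoszD.
rewrite /qnum !opprD !opprK !expfzDr // -!invr_expz expr1z.
have := expfz_neq0 k q_neq0; have := expfz_neq0 d q_neq0.
move: (q ^ d) (q ^ k) => y x y_neq0 x_neq0.
field; rewrite q_neq0 x_neq0 y_neq0 /=.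
apply: contra_neq qq0 => q2; apply: (mulfI q_neq0).
by rewrite mulrBr mulfV // q2 mulr0.
Qed.

End WeightBasis.

(** * Irreducibility for distinct weights *)

Section StableSubspaces.
Variables (F : fieldType) (n : nat) (W : {vspace 'cV[F]_n}).

(** The product of the operators D - a_j over j <> k, with D the diagonal
    matrix, maps W to itself and kills every coordinate but the k-th, which it
    multiplies by a nonzero scalar. *)
Lemma diag_stable_coord (a : 'rV[F]_n) :
    injective (a 0) -> (forall v, v \in W -> diag_mx a *m v \in W) ->
  forall v k, v \in W -> v k 0 != 0 -> delta_mx k 0 \in W.
Proof.
move=> a_inj aW v k vW vk.
have kill (s : seq 'I_n) :
    \col_i ((\prod_(j <- s) (a 0 i - a 0 j)) * v i 0) \in W.
  elim: s => [|j s IHs].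
    by rewrite (_ : \col_i _ = v) //; apply/colP=> i; rewrite mxE big_nil mul1r.
  suff -> : \col_i (\prod_(m <- j :: s) (a 0 i - a 0 m) * v i 0)
    = diag_mx a *m \col_i (\prod_(m <- s) (a 0 i - a 0 m) * v i 0)
      - a 0 j *: \col_i (\prod_(m <- s) (a 0 i - a 0 m) * v i 0).
    by rewrite rpredB ?rpredZ ?aW.
  apply/colP=> i; rewrite mul_diag_mx !mxE big_cons.
  by rewrite -mulrA mulrBl.
have {kill} := kill [seq j <- enum 'I_n | j != k].
rewrite (_ : \col_i _ =
    (\prod_(j | j != k) (a 0 k - a 0 j) * v k 0) *: delta_mx k 0).
  rewrite rpredZeq mulf_eq0 (negbTE vk) orbF => /orP[|//].
  case/prodf_eq0=> j ne_jk; rewrite subr_eq0 (inj_eq a_inj).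
  by rewrite eq_sym (negbTE ne_jk).
apply/colP=> i; rewrite !mxE big_filter big_enum_cond /=.
rewrite eqxx andbT; case: eqP => [->|/eqP ne_ik]; first by rewrite mulr1.
by rewrite (bigD1 i) //= subrr !mul0r mulr0.
Qed.

Lemma stable_neighbour (M : 'M[F]_n) (a : 'rV[F]_n) :
    injective (a 0) -> (forall v, v \in W -> diag_mx a *m v \in W) ->
    (forall v, v \in W -> M *m v \in W) ->
  forall j k, M j k != 0 -> delta_mx k 0 \in W -> delta_mx j 0 \in W.
Proof.
move=> a_inj aW MW j k Mjk /MW kW.
apply: (diag_stable_coord a_inj aW kW).
by rewrite -colE mxE.
Qed.

End StableSubspaces.

Lemma ord_path_connected (n : nat) (P : 'I_n.+1 -> Prop) (k : 'I_n.+1) :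
    P k -> (forall i j : 'I_n.+1, i.+1 = j :> nat -> P i -> P j) ->
    (forall i j : 'I_n.+1, i = j.+1 :> nat -> P i -> P j) ->
  forall j, P j.
Proof.
move=> Pk up down.
have P0 : P ord0.
  case: k Pk; elim=> [|k IHk] lt_k Pk.
    by rewrite (_ : ord0 = Ordinal lt_k) //; apply: val_inj.
  exact/(IHk (ltnW lt_k))/(down _ _ _ Pk).
case; elim=> [|j IHj] lt_j.
  by rewrite (_ : Ordinal _ = ord0) //; apply: val_inj.
exact: up (IHj (ltnW lt_j)).
Qed.

Lemma tridiag_stable_trivial (F : fieldType) (n : nat)
    (W : {vspace 'cV[F]_n.+1}) (a : 'rV[F]_n.+1) (M : 'M[F]_n.+1) :
    injective (a 0) -> (forall v, v \in W -> diag_mx a *m v \in W) ->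
    (forall v, v \in W -> M *m v \in W) ->
    (forall j k : 'I_n.+1, j = k.+1 :> nat -> M j k != 0) ->
    (forall j k : 'I_n.+1, j.+1 = k :> nat -> M j k != 0) ->
  W = 0%VS \/ W = fullv.
Proof.
move=> a_inj aW MW Mup Mdown.
have [->|W_neq0] := eqVneq W 0%VS; [by left | right].
have /cV0Pn[k vk] : vpick W != 0 by rewrite vpick0.
have nbr := stable_neighbour a_inj aW MW.
have eW : forall j, delta_mx j 0 \in W.
  apply: (@ord_path_connected _ _ k).
  - exact: (diag_stable_coord a_inj aW (memv_pick W)).
  - by move=> i j /esym ij; apply: nbr; apply: Mup.
  - by move=> i j /esym ij; apply: nbr; apply: Mdown.
apply/vspaceP=> v; rewrite memvf (matrix_sum_delta v).
by apply: memv_suml => j _; rewrite big_ord1 rpredZ ?eW.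
Qed.

Section TOne.
Variables (C : numClosedFieldType) (q sq : C).
Hypotheses (q_neq0 : q != 0) (sqE : sq ^+ 2 = q).
Hypothesis q_not_root : forall n : nat, (0 < n)%N -> ~~ n.-unity_root q.
Variable d : nat.

Let T := T_one q sq d.
Let a := @weight C sq d.
Let b k := a k + (a k)^-1.

(** If b_k = 0 then a_k^2 = -1, whereas a_k^2 is an integral power of q. *)
Lemma weightDV_neq0 k : b k != 0.
Proof.
apply/negP; rewrite /b addr_eq0 -(inj_eq (mulfI (weight_neq0 q_neq0 sqE k))).
rewrite mulrN mulfV ?(weight_neq0 q_neq0 sqE) // (weightM q_neq0 sqE).
exact/negP/expz_neqN1.
Qed.

Lemma T_one_denominator : op_qH T + invmx (op_qH T) \in unitmx
  /\ invmx (op_qH T + invmx (op_qH T)) = diag_mx (\row_k (b k)^-1).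
Proof.
have -> : op_qH T + invmx (op_qH T) = diag_mx (\row_k b k).
  rewrite T_one_qHV // T_one_qH -raddfD; congr diag_mx.
  by apply/rowP=> k; rewrite !mxE.
have [|Su ->] := @diag_mx_unitV C d.+1 (\row_k b k).
  by move=> k; rewrite mxE weightDV_neq0.
by split=> //; congr diag_mx; apply/rowP=> k; rewrite !mxE.
Qed.

(** The difference for a_j and a_k is (a_j - a_k) (1 + (a_j a_k)^-1), and a_j
    a_k is an integral power of q, hence is not -1. *)
Lemma weightBV_inj : injective (fun k => a k - (a k)^-1).
Proof.
have a0 := weight_neq0 q_neq0 sqE.
move=> j k /eqP; rewrite -subr_eq0.
have -> : a j - (a j)^-1 - (a k - (a k)^-1)
    = (a j - a k) * (1 + (a j * a k)^-1).
  by field; rewrite !a0.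
rewrite mulf_eq0 (weightM q_neq0 sqE) invr_expz subr_eq0 [1 + _]addrC addr_eq0.
rewrite (negbTE (expz_neqN1 q_neq0 q_not_root _)) orbF => /eqP ajk.
have /eqP : q ^ (j%:Z - k%:Z) = 1.
  by rewrite -(weightV q_neq0 sqE) -[weight sq j]/(a j) ajk mulfV ?a0.
by rewrite expz_eq1 // subr_eq0 => /eqP[/val_inj].
Qed.

Lemma T_one_irreducible : exists R : {lrmorphism Uq_so3 sq -> 'M[C]_d.+1},
  so3_rep_of q T R /\ irreducible_rep R.
Proof.
have qq0 := q_subV_neq0 q_neq0 q_not_root.
have [Su DE] := T_one_denominator.
have Tsl2 := T_one_sl2 q_neq0 sqE q_not_root d.
have [R RT] := so3_rep_exists q_neq0 sqE qq0 Tsl2 Su.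
exists R; split=> // W WR; case: RT; rewrite DE => R1 R2 _.
pose c := 'i / (q - q^-1).
apply: (@tridiag_stable_trivial _ _ W (\row_k (c * (a k - (a k)^-1)))
  (R (I2 sq))).
- have c_neq0 : c != 0 by rewrite mulf_neq0 ?neq0Ci ?invr_eq0.
  by move=> j k; rewrite !mxE => /(mulfI c_neq0)/weightBV_inj.
- have <- : R (I1 sq) = diag_mx (\row_k (c * (a k - (a k)^-1))).
    rewrite R1 T_one_qHV // T_one_qH -raddfB -linearZ; congr diag_mx.
    by apply/rowP=> k; rewrite !mxE.
  by move=> v; apply: WR.
- by move=> v; apply: WR.
- move=> j k jk; rewrite R2 mul_mx_diag !mxE jk eqxx.
  rewrite [k.+2 == _]gtn_eqF // subr0 mulf_neq0 ?invr_eq0 ?weightDV_neq0 //.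
  rewrite qnum_eq0 // subr_eq0; have := ltn_ord j; rewrite jk ltnS.
  by apply: contraTneq => -[dk]; rewrite -leqNgt eq_leq.
- move=> j k jk; rewrite R2 mul_mx_diag !mxE jk eqxx.
  rewrite ltn_eqF ?ltnS -?jk // sub0r mulNr oppr_eq0.
  by rewrite mulf_neq0 ?invr_eq0 ?weightDV_neq0 ?qnum_eq0.
Qed.

End TOne.

(** * Reducibility through an operator commuting with the representation *)

(** The eigenspace of P for c is invariant because P commutes with the two
    generators, hence with the whole algebra. *)
Lemma reducible_of_commutant (F : fieldType) (sq : F) (n : nat)
    (R : {lrmorphism Uq_so3 sq -> 'M[F]_n.+1}) (P : 'M[F]_n.+1) (c : F)
    (v : 'cV[F]_n.+1) :
    P *m R (I1 sq) = R (I1 sq) *m P -> P *m R (I2 sq) = R (I2 sq) *m P ->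
    P *m v = c *: v -> v != 0 -> P != c%:M ->
  reducible_rep R.
Proof.
move=> PI1 PI2 Pv v_neq0 P_neq_c.
have PR : forall a, P *m R a = R a *m P.
  apply: Uq_so3_ind => [||//|k a b Pa Pb|a b Pa Pb] //.
  - by rewrite rmorph1 mulmx1 mul1mx.
  - by rewrite linearP mulmxDr mulmxDl -scalemxAr Pa Pb -scalemxAl.
  - by rewrite rmorphM -!mulmxE mulmxA Pa -mulmxA Pb mulmxA.
pose f : 'Hom('cV[F]_n.+1, 'cV[F]_n.+1) := linfun (mulmx (P - c%:M)).
have memW u : (u \in lker f) = (P *m u == c *: u).
  by rewrite memv_ker lfunE /= mulmxBl mul_scalar_mx subr_eq0.
exists (lker f); split=> [a u||].
- rewrite !memW => /eqP Pu; apply/eqP.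
  by rewrite mulmxA PR -mulmxA Pu scalemxAr.
- move=> W0; case/eqP: v_neq0; apply/eqP.
  by rewrite -memv0 -W0 memW Pv.
move=> WT; case/eqP: P_neq_c; apply/matrixP=> j k.
have : delta_mx k 0 \in lker f by rewrite WT memvf.
rewrite memW -colE -mul_scalar_mx -colE => /eqP/colP/(_ j).
by rewrite !mxE.
Qed.

(** Multiply the hypothesis by P on both sides. *)
Lemma skew_intertwine_sym (F : fieldType) (n : nat) (P X Y : 'M[F]_n) :
  P *m P = - 1%:M -> P *m X = - (Y *m P) -> P *m Y = - (X *m P).
Proof.
move=> PP PX.
have -> : P *m Y = P *m (- (Y *m P)) *m P.
  by rewrite mulmxN mulNmx -!mulmxA PP !mulmxN mulmx1 opprK.
by rewrite -PX mulmxA PP !mulNmx mul1mx.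
Qed.

Section Flip.
Variables (F : numFieldType) (q sq : F).
Variable d : nat.

Let T := T_one q sq d.

(** |m> is sent to (-1)^(l+m) |-m>.  Because of the alternating sign, [flip]
    exchanges E and - F, hence E and F on T^(i) and T^(-i), where F has changed
    sign.  There it anticommutes both with E - F and with q^H + q^-H, and so
    commutes with R(I_2). *)
Definition flip : 'M[F]_d.+1 :=
  \matrix_(j, k) if j == rev_ord k then (-1) ^+ k else 0.

Lemma mul_mx_flip (M : 'M[F]_d.+1) j k :
  (M *m flip) j k = M j (rev_ord k) * (-1) ^+ k.
Proof.
rewrite mxE (bigD1 (rev_ord k)) //= big1 => [|i ne_i].
  by rewrite mxE eqxx addr0.
by rewrite mxE (negbTE ne_i) mulr0.
Qed.

Lemma mul_flip_mx (M : 'M[F]_d.+1) j k :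
  (flip *m M) j k = (-1) ^+ rev_ord j * M (rev_ord j) k.
Proof.
rewrite mxE (bigD1 (rev_ord j)) //= big1 => [|i ne_i].
  by rewrite mxE rev_ordK eqxx addr0.
by rewrite mxE -(inj_eq rev_ord_inj) rev_ordK eq_sym (negbTE ne_i) mul0r.
Qed.

Lemma flip_E : flip *m op_E T = - (op_F T *m flip).
Proof.
apply/matrixP=> j k; rewrite mul_flip_mx [RHS]mxE mul_mx_flip !mxE /= !subSS.
have := ltn_ord k; have := ltn_ord j; rewrite !ltnS => le_jd le_kd.
have -> : (j.+1 == d - k :> nat)%N = (d - j == k.+1 :> nat)%N by lia.
case: eqP => [->|_]; last by rewrite mulr0 mul0r oppr0.
by rewrite exprS mulN1r mulNr mulrC -subzn.
Qed.

(** |m> and |-m> are 2m steps apart, an odd number for odd d. *)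
Lemma flip_sqr : odd d -> flip *m flip = - 1%:M.
Proof.
move=> d_odd; apply/matrixP=> j k.
rewrite mul_flip_mx !mxE (inj_eq rev_ord_inj).
case: eqP => [->|_]; last by rewrite mulr0 oppr0.
rewrite -exprD -signr_odd /= subSS subnK; last by rewrite -ltnS.
by rewrite d_odd expr1 mulr1n.
Qed.

Lemma flip_F : odd d -> flip *m op_F T = - (op_E T *m flip).
Proof.
by move=> d_odd; apply: skew_intertwine_sym (flip_sqr d_odd) flip_E.
Qed.

Hypotheses (q_neq0 : q != 0) (sqE : sq ^+ 2 = q).

Lemma flip_qH : flip *m op_qH T = invmx (op_qH T) *m flip.
Proof.
have weight_rev k : weight sq (rev_ord k) = (weight sq k)^-1.
  apply: (mulfI (weight_neq0 q_neq0 sqE k)).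
  rewrite mulfV ?(weight_neq0 q_neq0 sqE) // (weightM q_neq0 sqE) /= subSS.
  by rewrite subnKC ?subrr ?expr0z // -ltnS.
apply/matrixP=> j k; rewrite mul_flip_mx mul_mx_flip T_one_qHV // T_one_qH !mxE.
rewrite -(inj_eq rev_ord_inj) rev_ordK !mulrb mulrC.
case: eqP => [->|_]; last first.
  by rewrite !mul0r.
by rewrite rev_ordK weight_rev invrK.
Qed.

End Flip.

(** Both sides of the last relation change sign: E F - F E because F does, and
    (q^H)^2 - (q^-H)^2 because eps^2 = -1. *)
Lemma sl2_relations_twist (F : fieldType) (q eps : F) (n : nat)
    (T : sl2_ops F n) :
    eps ^+ 2 = -1 -> sl2_relations q T ->
  sl2_relations q (Sl2Ops (eps *: op_qH T) (op_E T) (- op_F T)).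
Proof.
move=> epsE [Hu HE HG EG]; have eps_unit : eps \is a GRing.unit.
  by rewrite unitfE -sqrf_eq0 epsE oppr_eq0 oner_eq0.
split=> /=.
- by rewrite unitmxZ.
- by rewrite -scalemxAl HE -scalemxAr !scalerA mulrC.
- by rewrite -scalemxAl -scalemxAr mulmxN mulNmx HG !scalerN !scalerA mulrC.
rewrite invmxZ ?unitmxZ // -!scalemxAl -!scalemxAr !scalerA -invfM -expr2 epsE.
by rewrite mulmxN mulNmx -opprD EG invrN1 !scaleN1r -opprD scalerN.
Qed.

Section TIm.
Variables (C : numClosedFieldType) (q sq eps : C).
Hypotheses (q_neq0 : q != 0) (sqE : sq ^+ 2 = q) (epsE : eps ^+ 2 = -1).
Hypothesis q_not_root : forall n : nat, (0 < n)%N -> ~~ n.-unity_root q.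
Variable d : nat.
Hypothesis d_odd : odd d.

Let T1 := T_one q sq d.
Let T := T_im q sq d eps.

Let eps_neq0 : eps != 0.
Proof. by rewrite -sqrf_eq0 epsE oppr_eq0 oner_eq0. Qed.

Let epsV : eps^-1 = - eps.
Proof.
by apply: (mulfI eps_neq0); rewrite mulfV // mulrN -expr2 epsE opprK.
Qed.

Lemma T_im_qHV : invmx (op_qH T) = - eps *: invmx (op_qH T1).
Proof.
by rewrite invmxZ ?epsV // unitmxZ ?T_one_qH_unit // unitfE.
Qed.

(** The weights q^m satisfy q^(2m) <> 1 since 2m is odd. *)
Lemma T_im_denominator_unit : op_qH T + invmx (op_qH T) \in unitmx.
Proof.
rewrite T_im_qHV -[op_qH T]/(eps *: op_qH T1) T_one_qHV // T_one_qH.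
have -> : eps *: diag_mx (\row_k weight sq k)
    + - eps *: diag_mx (\row_k (weight sq k)^-1)
    = diag_mx (\row_(k < d.+1) (eps * (weight sq k - (weight sq k)^-1))).
  rewrite -!linearZ -raddfD; congr diag_mx; apply/rowP=> k; rewrite !mxE.
  by rewrite mulrBr mulNr.
apply: (diag_mx_unitV _).1 => k; rewrite mxE mulf_neq0 //.
have w_neq0 := weight_neq0 q_neq0 sqE k.
rewrite subr_eq0 -(inj_eq (mulfI w_neq0)) mulfV // (weightM q_neq0 sqE).
rewrite expz_eq1 // subr_eq0; apply: contraTneq d_odd => -[<-].
by rewrite addnn odd_double.
Qed.

Lemma T_im_reducible : exists R : {lrmorphism Uq_so3 sq -> 'M[C]_d.+1},
  so3_rep_of q T R /\ reducible_rep R.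
Proof.
have qq0 := q_subV_neq0 q_neq0 q_not_root.
have Su := T_im_denominator_unit.
have Tsl2 : sl2_relations q T.
  exact/sl2_relations_twist/T_one_sl2.
have [R RT] := so3_rep_exists q_neq0 sqE qq0 Tsl2 Su.
exists R; split=> //; case: RT => R1 R2 _.
pose P := @flip C d.
have PH : P *m op_qH T = - (invmx (op_qH T) *m P).
  by rewrite T_im_qHV -scalemxAr flip_qH // -scalemxAl scaleNr opprK.
have PP : P *m P = - 1%:M by exact: flip_sqr.
have PHV : P *m invmx (op_qH T) = - (op_qH T *m P).
  exact: (skew_intertwine_sym PP PH).
have PS : P *m (op_qH T + invmx (op_qH T))
    = - ((op_qH T + invmx (op_qH T)) *m P).
  by rewrite mulmxDr PH PHV mulmxDl opprD addrC.
have PD : P *m invmx (op_qH T + invmx (op_qH T))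
    = - (invmx (op_qH T + invmx (op_qH T)) *m P).
  have := congr1 (fun M => invmx (op_qH T + invmx (op_qH T)) *m M
    *m invmx (op_qH T + invmx (op_qH T))) PS.
  rewrite mulmxN mulNmx !mulmxA mulVmx // mul1mx -!mulmxA mulmxV // mulmx1.
  by move=> ->; rewrite opprK.
(* As P^2 = -1 and eps^2 = -1, the operator 1 - eps P maps every vector to an
   eigenvector of P for eps; at the lowest vector the result is not zero. *)
pose e0 : 'cV[C]_d.+1 := delta_mx ord0 0.
have P00 : P ord0 ord0 = 0.
  rewrite mxE; case: eqP => // /(congr1 val); rewrite /= subSS subn0 => d0.
  by suff: odd 0 by []; rewrite [X in odd X]d0.
have P_col0 : (P *m e0) ord0 0 = 0 by rewrite -colE mxE.
apply: (@reducible_of_commutant _ _ _ _ P eps (e0 - eps *: (P *m e0))).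
- rewrite R1 -scalemxAr -scalemxAl mulmxBr PH PHV mulmxBl opprK.
  by rewrite [X in _ *: X = _]addrC.
- rewrite R2 -[op_E T]/(op_E T1) -[op_F T]/(- op_F T1) opprK mulmxA mulmxDr.
  rewrite flip_E flip_F // -opprD -mulmxDl [op_F T1 + _]addrC.
  by rewrite mulNmx -!mulmxA PD mulmxN opprK.
- rewrite mulmxBr -scalemxAr mulmxA PP mulNmx mul1mx scalerBr scalerA -expr2.
  by rewrite epsE scalerN scaleN1r !opprK addrC.
- apply/eqP=> /colP/(_ ord0)/eqP; rewrite mxE [X in _ + X]mxE [X in - X]mxE.
  by rewrite P_col0 mulr0 subr0 !mxE oner_eq0.
- apply/eqP=> /matrixP/(_ ord0 ord0)/eqP; rewrite P00 !mxE eqxx mulr1n eq_sym.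
  by rewrite (negbTE eps_neq0).
Qed.

End TIm.

Theorem proposition3 (K : realType) (q sq : K[i])
  (q_neq0 : q != 0) (sqE : sq ^+ 2 = q)
  (q_not_root : forall n : nat, (0 < n)%N -> ~~ n.-unity_root q) :
  (forall d : nat,
     exists R : {lrmorphism Uq_so3 sq -> 'M[K[i]]_d.+1},
       so3_rep_of q (T_one q sq d) R /\ irreducible_rep R) /\
  (forall d : nat, odd d ->
     (exists R : {lrmorphism Uq_so3 sq -> 'M[K[i]]_d.+1},
        so3_rep_of q (T_im q sq d 'i) R /\ reducible_rep R) /\
     (exists R : {lrmorphism Uq_so3 sq -> 'M[K[i]]_d.+1},
        so3_rep_of q (T_im q sq d (- 'i)) R /\ reducible_rep R)).
Proof.
have epsE : (- 'i : K[i]) ^+ 2 = -1 by rewrite sqrrN sqrCi.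
split=> [d|d d_odd]; first exact: T_one_irreducible.
by split; apply: T_im_reducible => //; apply: sqrCi.
Qed.
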